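(* Let $k>1$ be an integer and let $S(k,m)=\sum_{i=1}^m i^k$ for positive integers $m$. For a positive integer $n$ put $s=\left\lfloor\sqrt[k+1]{(k+1)n}\right\rfloor$. Then the $n$-th smallest positive integer not of the form $S(k,m)$ ($m\ge1$) equals $$a(n)=\begin{cases} n+s & \text{if } (k+1)(n+s)>\sum_{j=0}^{k}\binom{k+1}{j}B^+_j\, s^{k+1-j},\\ n+s-1 & \text{otherwise.}\end{cases}$$
   Context: $B^+_j$ denote the Bernoulli numbers with the convention $B^+_1=\frac12$, i.e. defined by $\frac{t}{1-e^{-t}}=\sum_{j\ge0}B^+_j\frac{t^j}{j!}$ (so $B^+_0=1$, $B^+_1=\frac12$, $B^+_2=\frac16$, ...). With this convention $\sum_{i=1}^m i^k=\frac{1}{k+1}\sum_{j=0}^k\binom{k+1}{j}B^+_j m^{k+1-j}$. *)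

(* Defs.v *)
From mathcomp Require Import all_boot all_order all_algebra all_field.

Set Implicit Arguments.
Unset Strict Implicit.
Unset Printing Implicit Defensive.

Import GRing.Theory Num.Theory.
Local Open Scope ring_scope.

(* Formal power series over the rationals, given by their coefficients. *)
Definition fps_mul (f g : nat -> rat) : nat -> rat :=
  fun n => \sum_(i < n.+1) f i * g (n - i)%N.

Definition egf (a : nat -> rat) : nat -> rat := fun n => a n / n`!%:R.

Definition fps_t : nat -> rat := fun n => (n == 1)%:R.

(* The series 1 - exp (- t). *)
Definition fps_1_sub_expN : nat -> rat :=
  fun n => (n == 0)%:R - (-1) ^+ n / n`!%:R.

(* The identity t / (1 - exp (- t)) = \sum_j B_j t^j / j!, with the
   denominator cleared since 1 - exp (- t) has no constant term. *)
Definition bernoulli_plus_egf (B : nat -> rat) : Prop :=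
  fps_mul (egf B) fps_1_sub_expN =1 fps_t.

Lemma bernoulli_plus_egfE (B : nat -> rat) :
  bernoulli_plus_egf B <->
  forall n, egf B n =
    (n == 0)%:R - \sum_(i < n) egf B i * fps_1_sub_expN (n.+1 - i)%N.
Proof.
have E0 : fps_1_sub_expN 0 = 0 by [].
have E1 : fps_1_sub_expN 1 = 1 by [].
have mulS n : fps_mul (egf B) fps_1_sub_expN n.+1 =
    \sum_(i < n) egf B i * fps_1_sub_expN (n.+1 - i)%N + egf B n.
  rewrite /fps_mul 2!big_ord_recr /= subnn E0 mulr0 addr0.
  by rewrite subSn // subnn E1 mulr1.
split=> [BE n | BE [|n]].
- by have := BE n.+1; rewrite mulS /fps_t eqSS => <-; rewrite addrC addKr.
- by rewrite /fps_mul big_ord1 subnn E0 mulr0.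
- by rewrite mulS BE addrC subrK.
Qed.

Lemma bernoulli_plus_exists : {B : nat -> rat | bernoulli_plus_egf B}.
Proof.
pose next (s : seq rat) := (size s == 0)%:R -
  \sum_(i < size s) s`_i * fps_1_sub_expN ((size s).+1 - i)%N.
pose cs n := iter n (fun s => rcons s (next s)) [::].
have size_cs n : size (cs n) = n by elim: n => //= n IHn; rewrite size_rcons IHn.
have nth_cs n i : (i < n)%N -> (cs n)`_i = next (cs i).
  elim: n => // n IHn; rewrite ltnS /= nth_rcons size_cs leq_eqVlt.
  by case/predU1P=> [-> | lt_in]; [rewrite ltnn eqxx | rewrite lt_in IHn].
exists (fun n => next (cs n) * n`!%:R); apply/bernoulli_plus_egfE => n.
have egfB i : egf (fun n => next (cs n) * n`!%:R) i = next (cs i).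
  by rewrite /egf mulfK // pnatr_eq0 -lt0n fact_gt0.
rewrite egfB {1}/next size_cs; congr (_ - _).
by apply: eq_bigr => i _; rewrite egfB nth_cs.
Qed.

Definition Bplus : nat -> rat := sval bernoulli_plus_exists.

Lemma BplusP : bernoulli_plus_egf Bplus.
Proof. exact: (svalP bernoulli_plus_exists). Qed.

Lemma Bplus_unique (B : nat -> rat) : bernoulli_plus_egf B -> B =1 Bplus.
Proof.
move=> /bernoulli_plus_egfE BE; have /bernoulli_plus_egfE PE := BplusP.
have egfB n : egf B n = egf Bplus n.
  elim/ltn_ind: n => n IHn; rewrite BE PE; congr (_ - _).
  by apply: eq_bigr => i _; rewrite IHn.
move=> n; apply: (@mulIf _ (n`!%:R)^-1); last exact: egfB.
by rewrite invr_eq0 pnatr_eq0 -lt0n fact_gt0.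
Qed.

Definition power_sum (k m : nat) : nat := \sum_(1 <= i < m.+1) i ^ k.

Definition not_power_sum (k N : nat) : Prop :=
  (0 < N)%N /\ ~ exists2 m, (0 < m)%N & N = power_sum k m.

(* [a] satisfies P and exactly n naturals <= a satisfy P; [s] lists them. *)
Definition nth_smallest (P : nat -> Prop) (n a : nat) : Prop :=
  P a /\ exists s : seq nat,
    [/\ uniq s, size s = n & forall x, x \in s <-> P x /\ (x <= a)%N].

(* The floor of the real r-th root of x; algC's [r.-root] is the nonnegative
   real root on nonnegative reals, where [Num.truncn] is the floor. *)
Definition floor_root (r x : nat) : nat := Num.truncn (r.-root (x%:R : algC)).

(* Main.v *)
(* The number [n + m] is the [n]-th non-value of S(m) = S(k, m) as soon as
   S(m) < n + m < S(m + 1), since exactly m values then lie below it.  By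
   Faulhaber's formula the test in the theorem reads S(s) < n + s, so it
   decides between m = s and m = s - 1, and what remains are the two bounds
   (k+1) S(s-1) < s^(k+1) and (s+1)^(k+1) <= (k+1) (S(s+1) - s). *)
Require Import Defs.
From mathcomp Require Import all_boot all_order all_algebra all_field.
From mathcomp Require Import zify ring.

Set Implicit Arguments.
Unset Strict Implicit.
Unset Printing Implicit Defensive.

Import GRing.Theory Num.Theory.
Local Open Scope ring_scope.

(** The coefficient of degree [n] sees only terms of degree at most [n], so ring laws for series can
    be borrowed from truncations to polynomials. *)
Lemma fps_mul_coef (f g : nat -> rat) (p q : {poly rat}) n :
    (forall i, (i <= n)%N -> p`_i = f i) ->
    (forall i, (i <= n)%N -> q`_i = g i) ->
  fps_mul f g n = (p * q)`_n.
Proof.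
move=> pf qg; rewrite coefM; apply: eq_bigr => i _.
by rewrite pf ?qg ?leq_subr // -ltnS.
Qed.

Lemma fps_mulA (f g h : nat -> rat) :
  fps_mul f (fps_mul g h) =1 fps_mul (fps_mul f g) h.
Proof.
move=> n; pose T (h : nat -> rat) := \poly_(i < n.+1) h i.
have TE u i : (i <= n)%N -> (T u)`_i = u i by rewrite coef_poly ltnS => ->.
have TM u v i : (i <= n)%N -> (T u * T v)`_i = fps_mul u v i.
  by move=> le_in; rewrite (@fps_mul_coef _ _ (T u) (T v)) // => j le_ji;
    apply/TE/(leq_trans le_ji).
rewrite (@fps_mul_coef _ _ (T f) (T g * T h)); [|exact: TE|exact: TM].
by rewrite (@fps_mul_coef _ _ (T f * T g) (T h)) ?mulrA; [|exact: TM|exact: TE].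
Qed.

Lemma eq_fps_mul (f f' g g' : nat -> rat) :
  f =1 f' -> g =1 g' -> fps_mul f g =1 fps_mul f' g'.
Proof. by move=> ff' gg' n; apply: eq_bigr => i _; rewrite ff' gg'. Qed.

Lemma fact_neq0 n : n`!%:R != 0 :> rat.
Proof. by rewrite pnatr_eq0 -lt0n fact_gt0. Qed.

(** The series exp (x t). *)
Definition fps_exp (x : rat) : nat -> rat := fun n => x ^+ n / n`!%:R.

Lemma fps_expD (x y : rat) : fps_mul (fps_exp x) (fps_exp y) =1 fps_exp (x + y).
Proof.
move=> n; rewrite /fps_exp addrC exprDn mulr_suml; apply: eq_bigr => i _.
rewrite -(bin_fact (leq_ord i)) !natrM -(mulr_natr (_ * _)).
have bin_neq0 : 'C(n, i)%:R != 0 :> rat.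
  by rewrite pnatr_eq0 -lt0n bin_gt0 leq_ord.
by field; rewrite bin_neq0 !fact_neq0.
Qed.

(** Since exp (- t) exp (x t) = exp ((x - 1) t), the Bernoulli denominator acts on exp (x t) as a
    backward difference in [x]. *)
Lemma fps_1_sub_expN_mul_exp (x : rat) n :
  fps_mul fps_1_sub_expN (fps_exp x) n = fps_exp x n - fps_exp (x - 1) n.
Proof.
rewrite -[x - 1]addrC -fps_expD /fps_mul.
rewrite (eq_bigr _ (fun i _ => mulrBl _ _ _)) sumrB; congr (_ - _).
rewrite big_ord_recl mul1r subn0 big1 ?addr0 // => i _.
by rewrite mul0r.
Qed.

Lemma fps_t_mul_exp (x : rat) n : fps_mul fps_t (fps_exp x) n.+1 = fps_exp x n.
Proof.
rewrite /fps_mul !big_ord_recl mul0r add0r mul1r subSS subn0 big1 ?addr0 //.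
by move=> i _; rewrite mul0r.
Qed.

Section Faulhaber.

Variable k : nat.

Let F (x : rat) : rat :=
  \sum_(0 <= j < k.+1) 'C(k.+1, j)%:R * Bplus j * x ^+ (k.+1 - j).

(** [F x] is, up to the factor (k+1)!, a coefficient of t exp (x t) / (1 - exp (- t)); the sum stops
    at j = k, hence the removal of the term j = k+1. *)
Lemma faulhaber_coef x :
  F x = k.+1`!%:R * fps_mul (egf Bplus) (fps_exp x) k.+1 - Bplus k.+1.
Proof.
rewrite /fps_mul big_ord_recr /= subnn.
have -> : fps_exp x 0 = 1 by rewrite /fps_exp expr0 fact0 divr1.
rewrite mulr1 mulrDr [_ * egf _ _]mulrC divfK ?fact_neq0 // addrK mulr_sumr.
rewrite /F big_mkord; apply: eq_bigr => i _.
rewrite -(bin_fact (ltnW (ltn_ord i))) !natrM /egf /fps_exp.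
by field; rewrite !fact_neq0.
Qed.

(** The constants [Bplus k.+1] cancel, and the difference in [x] brings in the factor 1 - exp (- t),
    which clears the denominator and leaves t exp (x t). *)
Lemma faulhaber_step x : F x - F (x - 1) = k.+1%:R * x ^+ k.
Proof.
rewrite !faulhaber_coef opprB addrA subrK -mulrBr -sumrB.
rewrite (eq_bigr (fun i : 'I__ => egf Bplus i *
    fps_mul fps_1_sub_expN (fps_exp x) (k.+1 - i))); last first.
  by move=> i _; rewrite fps_1_sub_expN_mul_exp mulrBr.
rewrite -/(fps_mul _ _ _) fps_mulA (eq_fps_mul BplusP (fun=> erefl)).
by rewrite fps_t_mul_exp factS natrM /fps_exp; field; rewrite fact_neq0.
Qed.

Lemma faulhaber m : F m%:R = (k.+1 * power_sum k m)%:R.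
Proof.
elim: m => [|m IHm].
  rewrite /power_sum big_geq // muln0 /F big_mkord big1 // => i _.
  by rewrite expr0n subn_eq0 leqNgt ltn_ord mulr0.
have Em : m.+1%:R - 1 = m%:R :> rat by rewrite -natr1 addrK.
have := faulhaber_step m.+1%:R; rewrite Em => /(canRL (subrK _)) ->.
rewrite IHm -natrX -natrM -natrD -mulnDr /power_sum.
by rewrite [in RHS]big_nat_recr //= addnC.
Qed.

End Faulhaber.

Local Open Scope nat_scope.

Lemma power_sumS k m : power_sum k m.+1 = power_sum k m + m.+1 ^ k.
Proof. by rewrite /power_sum big_nat_recr. Qed.

Lemma power_sum_mono k : {mono power_sum k : m m' / m <= m'}.
Proof.
apply: leq_mono; apply: homo_ltn => [? ? ?|m]; first exact: ltn_trans.
by rewrite power_sumS -addn1 leq_add2l expn_gt0.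
Qed.

(** Bernoulli-type inequality: multiply the case [k] by a + 1 and drop the term (k+1) a^k. *)
Lemma expS_diff_ge k a : k.+1 * a ^ k + a ^ k.+1 <= a.+1 ^ k.+1.
Proof.
elim: k => [|k IHk]; first by rewrite !expn1 expn0; lia.
rewrite [_.+1 ^ _]expnS; apply: leq_trans (leq_mul (leqnn _) IHk).
rewrite ![in leqRHS]expnS ![in leqLHS]expnS; lia.
Qed.

(** The extra k+1 on the left, summed over [a], yields the term [k.+1 * m] of [power_sum_ge]. The
    induction starts at k = 2, where the claim reduces to 1 <= 3a; for k = 1 it is false. *)
Lemma expS_diff_le k a : 1 < k -> 0 < a ->
  a.+1 ^ k.+1 + k.+1 <= a ^ k.+1 + k.+1 * a.+1 ^ k.
Proof.
case: k => // k; case: k => // k _ a_gt0.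
elim: k => [|k IHk]; first by rewrite !expnS !expn0; nia.
have := leq_mul (leqnn a.+1) IHk.
(* Multiplying the hypothesis by a + 1 leaves a surplus [a ^ k.+3], absorbed by one more copy of
   [a.+1 ^ k.+3]. *)
have : a ^ k.+3 <= a.+1 ^ k.+3 by rewrite leq_exp2r.
rewrite [a.+1 ^ k.+4]expnS [a ^ k.+4]expnS.
have : a.+1 * (k.+3 * a.+1 ^ k.+2) = k.+3 * a.+1 ^ k.+3 by rewrite mulnCA -expnS.
by move: (_ ^ _) (a ^ _) (_ ^ k.+2) => x y z; nia.
Qed.

Lemma power_sum_lt k m : k.+1 * power_sum k m < m.+1 ^ k.+1.
Proof.
elim: m => [|m IHm]; first by rewrite /power_sum big_geq // muln0 exp1n.
rewrite power_sumS mulnDr; have := expS_diff_ge k m.+1; lia.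
Qed.

Lemma power_sum_ge k m : 1 < k ->
  m.+1 ^ k.+1 + k.+1 * m <= k.+1 * power_sum k m.+1.
Proof.
move=> k_gt1; elim: m => [|m IHm].
  by rewrite power_sumS /power_sum big_geq // !exp1n; lia.
by rewrite power_sumS mulnDr mulnS; have := @expS_diff_le k m.+1 k_gt1 isT; lia.
Qed.

Lemma nth_not_power_sum k n m :
    power_sum k m < n + m < power_sum k m.+1 ->
  nth_smallest (not_power_sum k) n (n + m).
Proof.
case/andP=> ltSm ltmS; have S_mono := power_sum_mono k.
have S_lt := leqW_mono S_mono; have S_inj := incn_inj S_mono.
have S0 : power_sum k 0 = 0 by rewrite /power_sum big_geq.
split.
  split=> [|[j _ Ej]]; first exact: leq_ltn_trans ltSm.
  by move: ltSm ltmS; rewrite Ej !S_lt ltnS => lt_mj; rewrite leqNgt lt_mj.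
(* [T] lists all the values up to n + m, as S(m+1) already exceeds this bound; its complement in [I]
   is the required list. *)
pose T := [seq power_sum k j | j <- iota 1 m]; pose I := iota 1 (n + m).
have TP x : x <= n + m -> x \in T <-> exists2 j, 0 < j & x = power_sum k j.
  move=> le_x; split=> [/mapP[j]|[j j_gt0 Ex]].
    by rewrite mem_iota => /andP[j_gt0 _] ->; exists j.
  apply/mapP; exists j; rewrite // mem_iota j_gt0 add1n -S_lt -Ex.
  exact: leq_ltn_trans ltmS.
exists [seq x <- I | x \notin T]; split; first exact/filter_uniq/iota_uniq.
  (* [T] consists of m distinct members of [I], so n of the n + m members remain. *)
  rewrite size_filter; have := count_predC (mem T) I.
  rewrite -size_filter (perm_size (_ : perm_eq _ T)); last first.
    apply: uniq_perm; first exact/filter_uniq/iota_uniq.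
      by rewrite map_inj_uniq ?iota_uniq.
    move=> x; rewrite mem_filter; apply: andb_idr => /mapP[j].
    rewrite mem_iota add1n ltnS => /andP[j_gt0 le_jm] Ex.
    rewrite mem_iota add1n ltnS Ex -[X in X < _]S0 S_lt j_gt0.
    by rewrite (leq_trans _ (ltnW ltSm)) ?S_mono.
  by rewrite size_map !size_iota addnC => /addIn.
move=> x; rewrite mem_filter mem_iota add1n ltnS /not_power_sum.
split=> [/and3P[/negP Tx x_gt0 le_x]|[[x_gt0 Tx] le_x]].
  by split=> //; split=> // /(TP x le_x).
by rewrite x_gt0 le_x !andbT; apply/negP=> /(TP x le_x).
Qed.

Lemma floor_root_itv r x : 0 < r ->
  floor_root r x ^ r <= x < (floor_root r x).+1 ^ r.
Proof.
move=> r_gt0; set y : algC := (r.-root (x%:R))%R.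
have y_ge0 : (0 <= y)%R by rewrite rootC_ge0.
have /andP[le_y lt_y] := truncn_itv y_ge0.
rewrite -(ler_nat algC) -(ltr_nat algC) !natrX -(rootCK r_gt0 (x%:R)%R).
by rewrite lerXn2r ?ltrXn2r ?nnegrE //= ?gtn_eqF.
Qed.

Local Open Scope ring_scope.

Theorem theorem7 (k n : nat) (hk : (1 < k)%N) (hn : (0 < n)%N) :
  let s := floor_root k.+1 (k.+1 * n) in
  nth_smallest (not_power_sum k) n
    (if \sum_(0 <= j < k.+1) 'C(k.+1, j)%:R * Bplus j * s%:R ^+ (k.+1 - j)
          < (k.+1 * (n + s))%:R :> rat
     then (n + s)%N else (n + s - 1)%N).
Proof.
move=> s; rewrite faulhaber ltr_nat ltn_pmul2l //.
have /andP[] := floor_root_itv (k.+1 * n) (ltn0Sn k); rewrite -/s => le_s lt_s.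
have [ltS|leS] := ltnP.
  (* Here m = s: (k+1)(n + s) < (s+1)^(k+1) + (k+1) s <= (k+1) S(s+1). *)
  apply: nth_not_power_sum; rewrite ltS -(ltn_pmul2l (ltn0Sn k)) mulnDr.
  by apply: leq_trans (power_sum_ge s hk); rewrite ltn_add2r.
(* The root cannot be 0 here, as S(0) = 0 < n. Otherwise it is renamed s + 1, so that m = s. *)
case: s le_s {lt_s} leS => [|s] le_s leS.
  by move: leS; rewrite /power_sum big_geq //; lia.
rewrite addnS subn1 /=; apply: nth_not_power_sum.
(* The failed test is the upper bound; the lower one is (k+1) S(s) < (s+1)^(k+1) <= (k+1) n. *)
rewrite -addnS leS andbT -(ltn_pmul2l (ltn0Sn k)) mulnDr ltn_addr //.
exact: leq_trans (power_sum_lt k s) le_s.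
Qed.
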